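(* Let $L$ be a nonempty set equipped with a metric $d_L\colon L\times L\to[0,1]$, let $\mathcal{M}=(S,A,\tau,\rho,\ell)$ be an $L$-labelled continuous-time Markov chain, let $\lambda\in(0,1)$, and let $\mathcal{C}$ be a coupling structure for $\mathcal{M}$. Then $\delta_\lambda=\gamma^{\mathcal{C}}_\lambda$ if and only if there is no coupling structure $\mathcal{H}$ for $\mathcal{M}$ such that $\Gamma^{\mathcal{H}}_\lambda(\gamma^{\mathcal{C}}_\lambda)\sqsubset\gamma^{\mathcal{C}}_\lambda$ (i.e. $\Gamma^{\mathcal{H}}_\lambda(\gamma^{\mathcal{C}}_\lambda)\sqsubseteq\gamma^{\mathcal{C}}_\lambda$ and $\Gamma^{\mathcal{H}}_\lambda(\gamma^{\mathcal{C}}_\lambda)\neq\gamma^{\mathcal{C}}_\lambda$).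
   Context: An $L$-labelled CTMC is a tuple $\mathcal{M}=(S,A,\tau,\rho,\ell)$: $S$ nonempty finite set of states, $A\subseteq S$ absorbing states, $\tau\colon S\setminus A\to\mathcal{D}(S)$ transition probability function, $\rho\colon S\setminus A\to\mathbb{R}_{>0}$ exit rates, $\ell\colon S\to L$ labelling. $s\equiv_A t$ means $s,t\in A$ or $s,t\notin A$. $\mathsf{exp}[r]$ is the exponential distribution of rate $r$ on $\mathbb{R}$; $\|\mu-\nu\|_{TV}=\sup_E|\mu(E)-\nu(E)|$ over Borel sets. $\Omega(\mu,\nu)$ is the set of couplings (joint distributions on $S\times S$ with marginals $\mu,\nu$); $\mathcal{K}_d(\mu,\nu)=\min_{\omega\in\Omega(\mu,\nu)}\sum_{u,v}d(u,v)\omega(u,v)$. Let $\alpha(s,t)=\|\mathsf{exp}[\rho(s)]-\mathsf{exp}[\rho(t)]\|_{TV}$, $\beta(s,t)=d_L(\ell(s),\ell(t))$. The operator $\Delta_\lambda$ on $[0,1]^{S\times S}$ is $\Delta_\lambda(d)(s,t)=1$ if $s\not\equiv_A t$; $\beta(s,t)$ if $s,t\in A$; $\max\{\beta(s,t),\lambda(\alpha(s,t)+(1-\alpha(s,t))\mathcal{K}_d(\tau(s),\tau(t)))\}$ if $s,t\notin A$; $\delta_\lambda$ is its least fixed point w.r.t. the pointwise order $\sqsubseteq$. A coupling structure for $\mathcal{M}$ is a function $\mathcal{C}\colon(S\setminus A)\times(S\setminus A)\to\mathcal{D}(S\times S)$ with $\mathcal{C}(s,t)\in\Omega(\tau(s),\tau(t))$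 for all $s,t\notin A$. $\Gamma^{\mathcal{C}}_\lambda$ is defined like $\Delta_\lambda$ but with $\mathcal{K}_d(\tau(s),\tau(t))$ replaced by $\sum_{u,v\in S}d(u,v)\mathcal{C}(s,t)(u,v)$; it is monotone and $\gamma^{\mathcal{C}}_\lambda$ is its least fixed point. *)

(* Defs.v *)
From HB Require Import structures.
From mathcomp Require Import all_boot all_order all_algebra.
From mathcomp Require Import all_classical all_reals all_analysis.
From mathcomp Require Import lra.

Set Implicit Arguments.
Unset Strict Implicit.
Unset Printing Implicit Defensive.

Import Order.TTheory GRing.Theory Num.Theory.
Import numFieldNormedType.Exports.

Local Open Scope classical_set_scope.
Local Open Scope ring_scope.

Record fdist (R : realType) (T : finType) := FDist {
  pmf :> {ffun T -> R};
  pmf_ge0 : forall x, 0 <= pmf x;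
  pmf_sum1 : \sum_x pmf x = 1 }.

Record ctmc (R : realType) (L : Type) := CTMC {
  state : finType;
  state_gt0 : (0 < #|state|)%N;
  absorbing : {set state};
  trans : {s : state | s \notin absorbing} -> fdist R state;
  rate : {s : state | s \notin absorbing} -> {posnum R};
  label : state -> L }.

Definition live (R : realType) (L : Type) (M : ctmc R L) :=
  {s : state M | s \notin absorbing M}.

Definition couplings (R : realType) (S : finType) (mu nu : fdist R S) :
    set (fdist R (S * S)%type) :=
  [set w | (forall u, \sum_v w (u, v) = mu u) /\
           (forall v, \sum_u w (u, v) = nu v)].

Definition expectation2 (R : realType) (S : finType) (d : S -> S -> R)
    (w : fdist R (S * S)%type) : R :=
  \sum_u \sum_v d u v * w (u, v).

(* The infimum is attained: see kantorovich_attained. *)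
Definition kantorovich (R : realType) (S : finType) (d : S -> S -> R)
    (mu nu : fdist R S) : R :=
  inf [set expectation2 d w | w in couplings mu nu].

Definition tv_dist (R : realType) (disp : measure_display)
    (T : measurableType disp) (mu nu : set T -> \bar R) : R :=
  sup [set `|fine (mu E) - fine (nu E)| | E in measurable].

Definition rate_dist (R : realType) (L : Type) (M : ctmc R L)
    (s t : live M) : R :=
  tv_dist (exponential_prob (rate s)%:num) (exponential_prob (rate t)%:num).

Definition label_dist (R : realType) (L : metricType R) (M : ctmc R L)
    (s t : state M) : R :=
  mdist (label s) (label t).

(* insub s is None exactly when s is absorbing, so the third branch is the case
   where one of the two states is absorbing and the other is not; k stands for
   the transport term. *)
Definition step (R : realType) (L : metricType R) (M : ctmc R L) (lambda : R)
    (k : live M -> live M -> R) (s t : state M) : R :=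
  match insub s : option (live M), insub t : option (live M) with
  | Some s', Some t' =>
      Num.max (label_dist s t)
        (lambda * (rate_dist s' t' + (1 - rate_dist s' t') * k s' t'))
  | None, None => label_dist s t
  | _, _ => 1
  end.

Definition Delta (R : realType) (L : metricType R) (M : ctmc R L) (lambda : R)
    (d : state M -> state M -> R) : state M -> state M -> R :=
  step lambda (fun s t => kantorovich d (trans s) (trans t)).

Arguments Delta {R L} M lambda d.

Record coupling_structure (R : realType) (L : Type) (M : ctmc R L) :=
  CouplingStructure {
    coupling_fun :> live M -> live M -> fdist R (state M * state M)%type;
    coupling_funP : forall s t : live M,
      couplings (trans s) (trans t) (coupling_fun s t) }.

Definition Gamma (R : realType) (L : metricType R) (M : ctmc R L) (lambda : R)
    (C : coupling_structure M) (d : state M -> state M -> R) :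
    state M -> state M -> R :=
  step lambda (fun s t => expectation2 d (C s t)).

Definition unit_valued (R : realType) (S : Type) (d : S -> S -> R) :=
  forall s t, 0 <= d s t <= 1.

Definition is_lfp (R : realType) (S : Type)
    (F : (S -> S -> R) -> S -> S -> R) (d : S -> S -> R) :=
  [/\ unit_valued d, F d = d &
      forall d', unit_valued d' -> F d' = d' -> (d <= d')%O].

(* The default value is never used for the operators at hand: delta_lfp and
   gamma_lfp show that their least fixed points exist. *)
Definition lfp (R : realType) (S : Type)
    (F : (S -> S -> R) -> S -> S -> R) : S -> S -> R :=
  xget (fun _ _ => 0) [set d | is_lfp F d].

Definition delta (R : realType) (L : metricType R) (M : ctmc R L)
    (lambda : R) : state M -> state M -> R :=
  lfp (Delta M lambda).

Arguments delta {R L} M lambda.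

Definition gamma (R : realType) (L : metricType R) (M : ctmc R L)
    (lambda : R) (C : coupling_structure M) : state M -> state M -> R :=
  lfp (Gamma lambda C).

Lemma lfpP (R : realType) (S : Type) (F : (S -> S -> R) -> S -> S -> R) :
  (forall d, unit_valued d -> unit_valued (F d)) ->
  (forall d d', unit_valued d -> unit_valued d' ->
    (forall s t, d s t <= d' s t) -> forall s t, F d s t <= F d' s t) ->
  is_lfp F (lfp F).
Proof.
move=> Fu Fmono; apply: xgetPex.
pose P := [set d : S -> S -> R |
  unit_valued d /\ forall s t, F d s t <= d s t].
have u1 : unit_valued (fun _ _ : S => 1 : R) by move=> s t; rewrite ler01 lexx.
have P1 : P (fun _ _ => 1) by split=> // s t; have /andP[] := Fu _ u1 s t.
pose m s t := inf [set d s t | d in P].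
have mP d s t : P d -> m s t <= d s t.
  move=> Pd; apply: ge_inf; last by exists d.
  by exists 0 => _ [e [eu _] <-]; have /andP[] := eu s t.
have Pm s t x : (forall d, P d -> x <= d s t) -> x <= m s t.
  move=> Px; apply: lb_le_inf; first by exists 1; exists (fun _ _ => 1).
  by move=> _ [d Pd <-]; exact: Px.
have mu : unit_valued m.
  move=> s t; apply/andP; split; last exact: mP P1.
  by apply: Pm => d [du _]; have /andP[] := du s t.
have Fm s t : F m s t <= m s t.
  apply: Pm => d Pd; apply: le_trans (Pd.2 s t).
  by apply: Fmono => //; [exact: Pd.1|move=> *; exact: mP].
exists m; split=> //.
- apply/funext => s; apply/funext => t; apply/le_anti; rewrite Fm /=.
  by apply: mP; split; [exact: Fu|apply: Fmono => //; exact: Fu].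
- move=> d du Fd; apply/asboolP => s; apply/asboolP => t.
  by apply: mP; split=> // *; rewrite Fd.
Qed.

Lemma tv_dist01 (R : realType) (disp : measure_display)
    (T : measurableType disp) (P Q : probability T R) :
  0 <= tv_dist P Q <= 1.
Proof.
have fp (P' : probability T R) E : measurable E -> 0 <= fine (P' E) <= 1.
  move=> mE; rewrite fine_ge0//= -lee_fin fineK ?probability_le1//.
  by rewrite ge0_fin_numE// (le_lt_trans (probability_le1 P' mE)) ?ltry.
have ub : ubound [set `|fine (P E) - fine (Q E)| | E in measurable] 1.
  move=> _ [E mE <-]; have /andP[] := fp P E mE; have /andP[] := fp Q E mE.
  by move=> *; rewrite ler_norml; apply/andP; split; lra.
rewrite /tv_dist; apply/andP; split.
  apply: (@le_trans _ _ `|fine (P set0) - fine (Q set0)|) => //.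
  by apply: ub_le_sup; [exists 1|exists set0].
apply: ge_sup => //; exists `|fine (P set0) - fine (Q set0)|.
by exists set0.
Qed.

Lemma rate_dist01 (R : realType) (L : Type) (M : ctmc R L) (s t : live M) :
  0 <= rate_dist s t <= 1.
Proof.
have rate_pos (r : {posnum R}) : 0 < r%:num by [].
pose P r :=
  exponential_distribution_exponential_prob__canonical__probability_measure_Probability
    (rate_pos r).
exact: (tv_dist01 (P (rate s)) (P (rate t))).
Qed.

Lemma expectation2_ge0 (R : realType) (S : finType) (d : S -> S -> R)
    (w : fdist R (S * S)%type) :
  (forall u v, 0 <= d u v) -> 0 <= expectation2 d w.
Proof.
by move=> d0; do 2!apply: sumr_ge0 => ? _; rewrite mulr_ge0 ?pmf_ge0.
Qed.

Lemma expectation2_le (R : realType) (S : finType) (d d' : S -> S -> R)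
    (w : fdist R (S * S)%type) :
  (forall u v, d u v <= d' u v) -> expectation2 d w <= expectation2 d' w.
Proof.
by move=> dd; do 2!apply: ler_sum => ? _; rewrite ler_wpM2r ?pmf_ge0.
Qed.

Lemma expectation2_le1 (R : realType) (S : finType) (d : S -> S -> R)
    (w : fdist R (S * S)%type) :
  (forall u v, d u v <= 1) -> expectation2 d w <= 1.
Proof.
move=> d1; apply: le_trans (expectation2_le w d1) _.
rewrite /expectation2; under eq_bigr do under eq_bigr do rewrite mul1r.
rewrite pair_bigA /= -(pmf_sum1 w) le_eqVlt; apply/orP; left; apply/eqP.
by apply: eq_bigr => -[].
Qed.

Lemma couplings_neq0 (R : realType) (S : finType) (mu nu : fdist R S) :
  couplings mu nu !=set0.
Proof.
pose f := [ffun x : S * S => mu x.1 * nu x.2].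
have f0 x : 0 <= f x by rewrite ffunE mulr_ge0 ?pmf_ge0.
have m1 u : \sum_v f (u, v) = mu u.
  by under eq_bigr do rewrite ffunE /=; rewrite -big_distrr /= pmf_sum1 mulr1.
have m2 v : \sum_u f (u, v) = nu v.
  by under eq_bigr do rewrite ffunE /=; rewrite -big_distrl /= pmf_sum1 mul1r.
have f1 : \sum_x f x = 1.
  rewrite -(pmf_sum1 mu) -(eq_bigr _ (fun u _ => m1 u)) pair_bigA /=.
  by apply: eq_bigr => -[].
by exists (FDist f0 f1).
Qed.

Lemma kantorovich_attained (R : realType) (S : finType) (d : S -> S -> R)
    (mu nu : fdist R S) :
  exists2 w, couplings mu nu w & kantorovich d mu nu = expectation2 d w.
Proof.
pose T := prod_topology (fun _ : S * S => R).
have csum (J : finType) (g : J -> T -> R) :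
    (forall j, continuous (g j)) -> continuous (fun f => \sum_j g j f).
  move=> gc; apply: (@continuous_big R) => // x.
  exact: (@pseudometric_normed_Zmodule.add_continuous R R^o x).
have cproj i : continuous (fun f : T => f i).
  exact: (@proj_continuous _ (fun _ : S * S => R) i).
have Kc : @compact T [set f | forall i, `[0, 1]%classic (f i)].
  exact: (@tychonoff _ (fun _ : S * S => R) (fun=> `[0, 1]%classic)
    (fun=> @segment_compact R 0 1)).
pose B1 := \bigcap_(u in [set: S])
  ((fun f : T => \sum_v f (u, v)) @^-1` [set mu u]).
pose B2 := \bigcap_(v in [set: S])
  ((fun f : T => \sum_u f (u, v)) @^-1` [set nu v]).
have B1c : @closed T B1.
  apply: closed_bigI => u _; apply: preimage_closed; last exact: closed_eq.
  by move=> f _; apply: csum.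
have B2c : @closed T B2.
  apply: closed_bigI => v _; apply: preimage_closed; last exact: closed_eq.
  by move=> f _; apply: csum.
have Ac := compact_closedI (compact_closedI Kc B1c) B2c.
have toA w : couplings mu nu w ->
    ([set f : T | forall i, `[0, 1]%classic (f i)] `&` B1 `&` B2)
      (fun x => w x).
  move=> [w1 w2]; split; [split|] => [x|u _|v _] /=; last 2 first.
  - exact: w1.
  - exact: w2.
  rewrite in_itv /= pmf_ge0 /= -(pmf_sum1 w) (bigD1 x) //= lerDl.
  by apply: sumr_ge0 => *; exact: pmf_ge0.
have [w0 w0P] := couplings_neq0 mu nu.
pose E (f : T) := \sum_u \sum_v d u v * f (u, v).
have Ec : continuous E.
  apply: (csum S (fun u f => \sum_v d u v * f (u, v))) => u.
  apply: (csum S (fun v f => d u v * f (u, v))) => v f.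
  exact: (@cvgMl_tmp _ _ (nbhs f) _
    (fun g : T => g (u, v)) (d u v) _ (cproj (u, v) f)).
have [|f] := compact_EVT_min _ Ac (continuous_subspaceT Ec).
  by exists (fun x => w0 x); exact: toA.
rewrite inE => -[[/= f01 f1] f2] fmin.
have pE x : [ffun x => f x] x = f x by rewrite ffunE.
have p0 x : 0 <= [ffun x => f x] x.
  by rewrite pE; have := f01 x; rewrite in_itv /= => /andP[].
have ps : \sum_x [ffun x => f x] x = 1.
  under eq_bigr do rewrite pE.
  rewrite -(pmf_sum1 mu) -(eq_bigr _ (fun u _ => f1 u Logic.I)) pair_bigA /=.
  by apply: eq_bigr => -[].
pose w := FDist p0 ps.
have wP : couplings mu nu w.
  split => [u|v]; under eq_bigr do rewrite pE; [exact: f1|exact: f2].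
have wE : expectation2 d w = E f.
  by apply: eq_bigr => u _; apply: eq_bigr => v _; rewrite pE.
exists w => //; apply/le_anti/andP; split.
  apply: ge_inf; last by exists w.
  exists (E f) => _ [w' w'P <-]; exact/fmin/mem_set/toA.
apply: lb_le_inf; first by exists (expectation2 d w); exists w.
by move=> _ [w' w'P <-]; rewrite wE; exact/fmin/mem_set/toA.
Qed.

Lemma kantorovich01 (R : realType) (S : finType) (d : S -> S -> R)
    (mu nu : fdist R S) :
  unit_valued d -> 0 <= kantorovich d mu nu <= 1.
Proof.
move=> d01; have [w _ ->] := kantorovich_attained d mu nu.
rewrite expectation2_ge0 ?expectation2_le1 // => u v;
  by have /andP[] := d01 u v.
Qed.

Lemma kantorovich_le (R : realType) (S : finType) (d d' : S -> S -> R)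
    (mu nu : fdist R S) :
  unit_valued d -> (forall u v, d u v <= d' u v) ->
  kantorovich d mu nu <= kantorovich d' mu nu.
Proof.
move=> d01 dd; have [w wP ->] := kantorovich_attained d' mu nu.
apply: le_trans (expectation2_le w dd); apply: ge_inf; last by exists w.
exists 0 => _ [w' _ <-]; apply: expectation2_ge0 => u v.
by have /andP[] := d01 u v.
Qed.

Lemma step01 (R : realType) (L : metricType R) (M : ctmc R L) (lambda : R)
    (k : live M -> live M -> R) :
  (forall a b : L, mdist a b <= 1) -> 0 < lambda < 1 ->
  unit_valued k -> unit_valued (step lambda k).
Proof.
move=> d1 /andP[l0 l1] k01 s t; rewrite /step.
have b01 : 0 <= label_dist s t <= 1 by rewrite mdist_ge0 d1.
case: insub => [s'|]; case: insub => [t'|] //; rewrite ?ler01 ?lexx //.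
have /andP[a0 a1] := rate_dist01 s' t'; have /andP[k0 k1] := k01 s' t'.
have /andP[b0 b1] := b01.
set c := rate_dist s' t' + _.
have c0 : 0 <= c by rewrite addr_ge0 // mulr_ge0 // subr_ge0.
have c1 : c <= 1.
  rewrite -[leRHS](subrKC (rate_dist s' t')) lerD2l.
  by rewrite ler_piMr // subr_ge0.
by rewrite le_max b0 /= ge_max b1 /= mulr_ile1 // ltW.
Qed.

Lemma step_le (R : realType) (L : metricType R) (M : ctmc R L) (lambda : R)
    (k k' : live M -> live M -> R) :
  0 < lambda < 1 -> (forall s t, k s t <= k' s t) ->
  forall s t, step lambda k s t <= step lambda k' s t.
Proof.
move=> /andP[l0 l1] kk s t; rewrite /step.
case: insub => [s'|]; case: insub => [t'|] //; rewrite ?lexx //.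
rewrite ge_max le_max lexx /= le_max; apply/orP; right.
have /andP[a0 a1] := rate_dist01 s' t'.
by rewrite ler_pM2l // lerD2l ler_wpM2l // subr_ge0.
Qed.

Lemma delta_lfp (R : realType) (L : metricType R) (M : ctmc R L) (lambda : R) :
  (forall a b : L, mdist a b <= 1) -> 0 < lambda < 1 ->
  is_lfp (Delta M lambda) (delta M lambda).
Proof.
move=> d1 l01; apply: lfpP => [d d01|d d' d01 _ dd].
  by apply: step01 => // s t; exact: kantorovich01.
by apply: step_le => // s t; exact: kantorovich_le.
Qed.

Lemma gamma_lfp (R : realType) (L : metricType R) (M : ctmc R L) (lambda : R)
    (C : coupling_structure M) :
  (forall a b : L, mdist a b <= 1) -> 0 < lambda < 1 ->
  is_lfp (Gamma lambda C) (gamma lambda C).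
Proof.
move=> d1 l01; apply: lfpP => [d d01|d d' d01 _ dd].
  apply: step01 => // s t.
  rewrite expectation2_ge0 ?expectation2_le1 // => u v;
    by have /andP[] := d01 u v.
by apply: step_le => // s t; exact: expectation2_le.
Qed.

(* Main.v *)
Require Import Defs.
From mathcomp Require Import all_boot all_order all_algebra.
From mathcomp Require Import all_classical all_reals all_analysis.
Set Implicit Arguments.
Unset Strict Implicit.
Unset Printing Implicit Defensive.

Import Order.TTheory GRing.Theory Num.Theory.
Local Open Scope classical_set_scope.
Local Open Scope ring_scope.

(** [Delta d] is the pointwise minimum of the [Gamma H d] over all coupling
    structures [H], and it is attained: choose an optimal coupling for each pair
    of states. Hence some [Gamma H] strictly decreases [gamma C] iff [gamma C]
    is not a fixed point of [Delta]; and since the discount factor [lambda < 1]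
    makes [Delta] a contraction for the sup distance, its only fixed point is
    [delta]. *)

Lemma kantorovich_le_expectation2 (R : realType) (S : finType)
    (d : S -> S -> R) (mu nu : fdist R S) (w : fdist R (S * S)%type) :
  (forall u v, 0 <= d u v) -> couplings mu nu w ->
  kantorovich d mu nu <= expectation2 d w.
Proof.
move=> d0 wP; apply: ge_inf; last by exists w.
by exists 0 => _ [w' _ <-]; exact: expectation2_ge0.
Qed.

(** The total mass of [w] is one, so integrating the constant [m] gives back [m]. *)
Lemma expectation2_leD (R : realType) (S : finType) (d d' : S -> S -> R)
    (m : R) (w : fdist R (S * S)%type) :
  (forall u v, d' u v <= d u v + m) ->
  expectation2 d' w <= expectation2 d w + m.
Proof.
move=> dm; apply: le_trans (expectation2_le w dm) _.
rewrite /expectation2 -[X in _ + X]mulr1 -(pmf_sum1 w) mulr_sumr.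
rewrite (eq_bigr (fun p => m * w (p.1, p.2))); last by case.
rewrite -(pair_bigA _ (fun u v => m * w (u, v))) -big_split /=.
apply: ler_sum => u _.
by rewrite -big_split /= ler_sum // => v _; rewrite mulrDl.
Qed.

(** A coupling optimal for [d] is a competitor for [d']. Nonnegativity of [d'] bounds the infimum
    from below. *)
Lemma kantorovich_leD (R : realType) (S : finType) (d d' : S -> S -> R)
    (m : R) (mu nu : fdist R S) :
  (forall u v, 0 <= d' u v) -> (forall u v, d' u v <= d u v + m) ->
  kantorovich d' mu nu <= kantorovich d mu nu + m.
Proof.
move=> d'0 dm; have [w wP ->] := kantorovich_attained d mu nu.
by apply: le_trans (expectation2_leD w dm); exact: kantorovich_le_expectation2.
Qed.

(** One-sided contraction estimate: [1 - rate_dist] lies in [0,1], so an excess [m] in the transport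
    term is only scaled down before [lambda] multiplies it, and the maximum with the label distance
    does not enlarge it. *)
Lemma step_leD (R : realType) (L : metricType R) (M : ctmc R L) (lambda m : R)
    (k k' : live M -> live M -> R) :
  0 < lambda -> 0 <= m -> (forall s t, k' s t <= k s t + m) ->
  forall s t, step lambda k' s t <= step lambda k s t + lambda * m.
Proof.
move=> l0 m0 km s t; have lm0 : 0 <= lambda * m by rewrite mulr_ge0 // ltW.
rewrite /step; case: insub => [s'|]; case: insub => [t'|]; rewrite ?lerDl //.
rewrite ge_max; apply/andP; split; first by rewrite ler_wpDr // le_max lexx.
have /andP[a0 a1] := rate_dist01 s' t'.
apply: (@le_trans _ _ (lambda * (rate_dist s' t' +
  (1 - rate_dist s' t') * k s' t') + lambda * m)); last first.
  by rewrite lerD2r le_max lexx orbT.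
rewrite -mulrDr ler_pM2l // -addrA lerD2l.
apply: (@le_trans _ _ ((1 - rate_dist s' t') * (k s' t' + m))).
  by rewrite ler_wpM2l // subr_ge0.
by rewrite mulrDr lerD2l ler_piMl // gerBl.
Qed.

Lemma Delta_le_Gamma (R : realType) (L : metricType R) (M : ctmc R L)
    (lambda : R) (H : coupling_structure M) (d : state M -> state M -> R) :
  0 < lambda < 1 -> unit_valued d ->
  (Delta M lambda d <= Gamma lambda H d)%O.
Proof.
move=> l01 d01; apply/asboolP => s; apply/asboolP => t.
apply: step_le => // s' t'; apply: kantorovich_le_expectation2.
  by move=> u v; have /andP[] := d01 u v.
exact: coupling_funP.
Qed.

Lemma Delta_attained (R : realType) (L : metricType R) (M : ctmc R L)
    (lambda : R) (d : state M -> state M -> R) :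
  exists H : coupling_structure M, Gamma lambda H d = Delta M lambda d.
Proof.
have /choice[h hP] (p : live M * live M) : exists w,
    couplings (trans p.1) (trans p.2) w /\
    kantorovich d (trans p.1) (trans p.2) = expectation2 d w.
  have [w] := kantorovich_attained d (trans p.1) (trans p.2).
  by exists w.
exists (CouplingStructure (fun s t => (hP (s, t)).1)).
rewrite /Gamma /Delta; congr step.
by apply/funext => s; apply/funext => t; rewrite (hP (s, t)).2.
Qed.

(** Uniqueness in one-sided form: applying [Delta] shrinks the largest excess of [d'] over [d] by
    the factor [lambda], yet leaves both functions unchanged, so the excess vanishes. *)
Lemma Delta_fixpoint_le (R : realType) (L : metricType R) (M : ctmc R L)
    (lambda : R) (d d' : state M -> state M -> R) :
  0 < lambda < 1 -> (forall s t, 0 <= d' s t) ->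
  Delta M lambda d = d -> Delta M lambda d' = d' ->
  forall s t, d' s t <= d s t.
Proof.
move=> /andP[l0 l1] d'0 dE d'E s t.
(* The base value 0 makes [m] the positive part of the largest excess, as [step_leD] needs
   [0 <= m]. *)
pose m := \big[Num.max/0]_(p : state M * state M) (d' p.1 p.2 - d p.1 p.2).
have m0 : 0 <= m by exact: bigmax_ge_id.
have dm u v : d' u v <= d u v + m.
  by rewrite -lerBlDl; exact: (le_bigmax _ _ (u, v)).
have dlm u v : d' u v <= d u v + lambda * m.
  rewrite -{1}d'E -{1}dE; apply: step_leD => // s' t'.
  exact: kantorovich_leD.
have mlm : m <= lambda * m.
  apply: bigmax_le => [|p _]; first by rewrite mulr_ge0 // ltW.
  by rewrite lerBlDl.
suff mE : m = 0 by have := dm s t; rewrite mE addr0.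
apply/le_anti; rewrite m0 andbT.
by move: mlm; rewrite -subr_le0 -{1}[m]mul1r -mulrBl pmulr_rle0 ?subr_gt0.
Qed.

Theorem theorem4p4 (R : realType) (L : metricType R)
    (L_neq0 : [set: L] !=set0)
    (mdist_le1 : forall a b : L, mdist a b <= 1)
    (M : ctmc R L) (lambda : R) (lambda01 : 0 < lambda < 1)
    (C : coupling_structure M) :
  delta M lambda = gamma lambda C <->
  ~ exists H : coupling_structure M,
      (Gamma lambda H (gamma lambda C) < gamma lambda C)%O.
Proof.
have [d01 dE dmin] := delta_lfp M mdist_le1 lambda01.
have [g01 gE _] := gamma_lfp C mdist_le1 lambda01.
split=> [dg [H]|noH].
  (* Since [gamma] is now a fixed point of [Delta], it lies below its image under every
     [Gamma H]. *)
  have := Delta_le_Gamma H lambda01 g01; rewrite -{1}dg dE dg.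
  by move=> /le_lt_trans /[apply]; rewrite ltxx.
have [H HE] := Delta_attained lambda (gamma lambda C).
have Dg : Delta M lambda (gamma lambda C) = gamma lambda C.
  apply/eqP/negP => /negP neq; apply: noH; exists H.
  (* [C] itself is one of the competitors: [Delta] of [gamma] is below [Gamma lambda C] of [gamma],
     which is [gamma]. *)
  by rewrite lt_neqAle HE neq /= -{2}gE; exact: Delta_le_Gamma.
(* Leastness of [delta] gives one inequality; the contraction argument gives the other. *)
apply/le_anti; rewrite dmin //=; apply/asboolP => s; apply/asboolP => t.
by apply: (Delta_fixpoint_le lambda01) => // u v; have /andP[] := g01 u v.
Qed.
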